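(* For any $n\ge3$, $\boldsymbol n(1,2,3)\notin[\mathfrak b_n(4),\mathfrak b_n(1)]$.
   Context: Let $\mathcal L_n=\bigoplus_{k\ge1}\mathcal L_n(k)$ be the free Lie algebra over $\mathbf Z$ on the free abelian group $H$ with basis $x_1,\dots,x_n$, graded by weight, and let $x_1^*,\dots,x_n^*$ be the dual basis of $H^*$. Brackets $[a_1,\dots,a_k]$ are left-normed, also when some entries are themselves brackets. An element of $H^*\otimes_{\mathbf Z}\mathcal L_n(k+1)=\mathrm{Hom}_{\mathbf Z}(H,\mathcal L_n(k+1))$ is identified with the derivation of $\mathcal L_n$ of degree $k$ extending it; the bracket of derivations is $[f,g]=g\circ f-f\circ g$. For $k\ge1$, $\mathfrak p_n(k)$ is the $\mathbf Z$-submodule of $H^*\otimes\mathcal L_n(k+1)$ generated by all $x_i^*\otimes[x_{j_1},\dots,x_{j_k},x_i]$ with $1\le i,j_1,\dots,j_k\le n$, and $\mathfrak b_n(k)=\{\sum_i x_i^*\otimes C_i\in\mathfrak p_n(k)\mid\sum_iC_i=0\}$. The sum $\bigoplus_{k\ge1}\mathfrak b_n(k)$ is a Lie subalgebra of the derivation Lie algebra, and $[\mathfrak b_n(4),\mathfrak b_n(1)]\subset\mathfrak b_n(5)$ is the $\mathbf Z$-submodule spanned by brackets. For $1\le i,j,l,p,q,r\le n$ set $$\begin{aligned}\boldsymbol b(i,j,l,p,q,r)={}&x_i^*\otimes[x_r,x_q,x_p,x_l,x_j,x_i]-x_j^*\otimes[x_r,x_q,x_p,x_l,x_i,x_j]\\&-x_l^*\otimes[x_r,x_q,x_p,[x_j,x_i],x_l]-x_p^*\otimes[x_i,x_j,x_l,[x_q,x_r],x_p]\\&-x_q^*\otimes[x_i,x_j,x_l,x_p,x_r,x_q]+x_r^*\otimes[x_i,x_j,x_l,x_p,x_q,x_r]\in\mathfrak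 b_n(5),\end{aligned}$$ and $\boldsymbol n(i,j,l)=\boldsymbol b(l,j,i,l,j,i)-\boldsymbol b(l,j,l,i,j,i)\in\mathfrak b_n(5)$. *)

(* Defs.v *)
(* boolp is used only to turn the congruence below into a boolean equivalence
   relation, so that generic_quotient applies. *)
From HB Require Import structures.
From mathcomp Require Import all_boot all_order all_algebra.
From mathcomp Require Import boolp.

Set Implicit Arguments.
Unset Strict Implicit.
Unset Printing Implicit Defensive.

Import GRing.Theory.
Local Open Scope ring_scope.
Local Open Scope quotient_scope.

Section ZSpan.
Variable V : zmodType.

Inductive zspan (S : V -> Prop) : V -> Prop :=
| zspan0 : zspan S 0
| zspan_mem u : S u -> zspan S u
| zspanB u v : zspan S u -> zspan S v -> zspan S (u - v).

End ZSpan.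

(* The free Lie algebra over Z on 'I_n: formal expressions modulo the least
   congruence containing the axioms of Lie rings. *)

Inductive lterm (n : nat) : Type :=
| TGen of 'I_n
| TZero
| TOpp of lterm n
| TAdd of lterm n & lterm n
| TLie of lterm n & lterm n.
Arguments TZero {n}.

HB.instance Definition _ n := gen_eqMixin (lterm n).
HB.instance Definition _ n := gen_choiceMixin (lterm n).

Inductive lcong (n : nat) : lterm n -> lterm n -> Prop :=
| LRefl t : lcong t t
| LSym s t : lcong s t -> lcong t s
| LTrans s t u : lcong s t -> lcong t u -> lcong s u
| LOpp s t : lcong s t -> lcong (TOpp s) (TOpp t)
| LAdd s s' t t' : lcong s s' -> lcong t t' -> lcong (TAdd s t) (TAdd s' t')
| LLie s s' t t' : lcong s s' -> lcong t t' -> lcong (TLie s t) (TLie s' t')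
| LAddA s t u : lcong (TAdd s (TAdd t u)) (TAdd (TAdd s t) u)
| LAddC s t : lcong (TAdd s t) (TAdd t s)
| LAdd0 t : lcong (TAdd TZero t) t
| LAddN t : lcong (TAdd (TOpp t) t) TZero
| LLieDl s t u : lcong (TLie (TAdd s t) u) (TAdd (TLie s u) (TLie t u))
| LLieDr s t u : lcong (TLie s (TAdd t u)) (TAdd (TLie s t) (TLie s u))
| LLiexx t : lcong (TLie t t) TZero
| LJacobi s t u :
    lcong (TAdd (TAdd (TLie s (TLie t u)) (TLie t (TLie u s)))
                (TLie u (TLie s t))) TZero.

Section FreeLie.
Variable n : nat.

Definition lcongb (s t : lterm n) : bool := `[< lcong s t >].

Lemma lcongb_refl : reflexive lcongb.
Proof. by move=> t; apply/asboolP; exact: LRefl. Qed.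

Lemma lcongb_sym : symmetric lcongb.
Proof. by move=> s t; apply/asboolP/asboolP; exact: LSym. Qed.

Lemma lcongb_trans : transitive lcongb.
Proof.
move=> t s u /asboolP st /asboolP tu; apply/asboolP; exact: LTrans st tu.
Qed.

Canonical lcong_equiv := EquivRel lcongb lcongb_refl lcongb_sym lcongb_trans.

Definition freeLie := {eq_quot lcongb}.
HB.instance Definition _ := Choice.on freeLie.

Definition fl_class (t : lterm n) : freeLie := \pi_(freeLie) t.

Lemma fl_classP s t : fl_class s = fl_class t <-> lcong s t.
Proof. by split=> [/eqmodP/asboolP|st] //; apply/eqmodP/asboolP. Qed.

Lemma fl_reprK (a : freeLie) : fl_class (repr a) = a.
Proof. exact: reprK. Qed.

Lemma lcong_repr t : lcong (repr (fl_class t)) t.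
Proof. by apply/fl_classP; rewrite fl_reprK. Qed.

Definition fl_add (a b : freeLie) := fl_class (TAdd (repr a) (repr b)).
Definition fl_opp (a : freeLie) := fl_class (TOpp (repr a)).
Definition lie (a b : freeLie) := fl_class (TLie (repr a) (repr b)).
Definition gen (i : 'I_n) : freeLie := fl_class (TGen i).

Lemma fl_addE s t : fl_class (TAdd s t) = fl_add (fl_class s) (fl_class t).
Proof. by apply/fl_classP/LAdd; apply/LSym/lcong_repr. Qed.

Lemma fl_oppE t : fl_class (TOpp t) = fl_opp (fl_class t).
Proof. by apply/fl_classP/LOpp; apply/LSym/lcong_repr. Qed.

Lemma fl_lieE s t : fl_class (TLie s t) = lie (fl_class s) (fl_class t).
Proof. by apply/fl_classP/LLie; apply/LSym/lcong_repr. Qed.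

Lemma fl_addA : associative fl_add.
Proof.
move=> a b c; rewrite -(fl_reprK a) -(fl_reprK b) -(fl_reprK c) -!fl_addE.
exact/fl_classP/LAddA.
Qed.

Lemma fl_addC : commutative fl_add.
Proof.
by move=> a b; rewrite -(fl_reprK a) -(fl_reprK b) -!fl_addE; exact/fl_classP/LAddC.
Qed.

Lemma fl_add0 : left_id (fl_class TZero) fl_add.
Proof. by move=> a; rewrite -(fl_reprK a) -fl_addE; exact/fl_classP/LAdd0. Qed.

Lemma fl_addN : left_inverse (fl_class TZero) fl_opp fl_add.
Proof.
by move=> a; rewrite -(fl_reprK a) -fl_oppE -fl_addE; exact/fl_classP/LAddN.
Qed.

HB.instance Definition _ :=
  GRing.isZmodule.Build freeLie fl_addA fl_addC fl_add0 fl_addN.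

Lemma lieDl (a b c : freeLie) : lie (a + b) c = lie a c + lie b c.
Proof.
rewrite -(fl_reprK a) -(fl_reprK b) -(fl_reprK c) -[_ + _ in LHS]fl_addE.
by rewrite -!fl_lieE -[RHS]fl_addE; exact/fl_classP/LLieDl.
Qed.

Lemma lieDr (a b c : freeLie) : lie a (b + c) = lie a b + lie a c.
Proof.
rewrite -(fl_reprK a) -(fl_reprK b) -(fl_reprK c) -[_ + _ in LHS]fl_addE.
by rewrite -!fl_lieE -[RHS]fl_addE; exact/fl_classP/LLieDr.
Qed.

Lemma liexx (a : freeLie) : lie a a = 0.
Proof. by rewrite -(fl_reprK a) -fl_lieE; exact/fl_classP/LLiexx. Qed.

Lemma lie_jacobi (a b c : freeLie) :
  lie a (lie b c) + lie b (lie c a) + lie c (lie a b) = 0.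
Proof.
rewrite -(fl_reprK a) -(fl_reprK b) -(fl_reprK c) -!fl_lieE.
by rewrite -[X in X + _]fl_addE -[LHS]fl_addE; exact/fl_classP/LJacobi.
Qed.

Lemma lieC (a b : freeLie) : lie a b = - lie b a.
Proof.
apply/eqP; rewrite -addr_eq0; apply/eqP; have := liexx (a + b).
by rewrite lieDl !lieDr !liexx add0r addr0.
Qed.

(* Left-normed bracket [a_1, ..., a_k] = [...[[a_1, a_2], a_3], ..., a_k]. *)
Definition lnorm (s : seq freeLie) : freeLie :=
  if s is a :: s' then foldl lie a s' else 0.

(* H^* (x) L_n = Hom_Z(H, L_n): a homomorphism is given by its values on the
   basis of H, so that f stands for \sum_i x_i^* (x) f i. *)
Definition homL := {ffun 'I_n -> freeLie}.

Definition dual_tensor (i : 'I_n) (C : freeLie) : homL :=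
  [ffun m => if m == i then C else 0].

Lemma homL_sum (f : homL) : f = \sum_i dual_tensor i (f i).
Proof.
apply/ffunP=> m; rewrite sum_ffunE (bigD1 m) //= ffunE eqxx big1 ?addr0 //.
by move=> i /negPf; rewrite ffunE eq_sym => ->.
Qed.

Fixpoint tder (f : homL) (t : lterm n) : freeLie :=
  match t with
  | TGen i => f i
  | TZero => 0
  | TOpp s => - tder f s
  | TAdd s u => tder f s + tder f u
  | TLie s u => lie (tder f s) (fl_class u) + lie (fl_class s) (tder f u)
  end.

(* The derivation of L_n extending f : H -> L_n; see der_gen, derD, der_lie. *)
Definition der (f : homL) (a : freeLie) : freeLie := tder f (repr a).

Lemma tder_cong f s t : lcong s t -> tder f s = tder f t.
Proof.
elim=> {s t} //=.
- by move=> s t u _ -> _ ->.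
- by move=> s t _ ->.
- by move=> s s' t t' _ -> _ ->.
- by move=> s s' t t' /fl_classP-> -> /fl_classP-> ->.
- by move=> s t u; rewrite addrA.
- by move=> s t; rewrite addrC.
- by move=> t; rewrite add0r.
- by move=> t; rewrite addNr.
- by move=> s t u; rewrite [fl_class (TAdd _ _)]fl_addE !lieDl addrACA.
- by move=> s t u; rewrite [fl_class (TAdd _ _)]fl_addE !lieDr addrACA.
- by move=> t; rewrite lieC addNr.
move=> s t u; rewrite !fl_lieE !lieDr.
move: (tder f s) (tder f t) (tder f u) (fl_class s) (fl_class t) (fl_class u).
move=> a b c x y z.
have Ja := lie_jacobi a y z; have Jb := lie_jacobi b z x.
have Jc := lie_jacobi c x y.
transitivity (lie a (lie y z) + lie y (lie z a) + lie z (lie a y)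
  + (lie b (lie z x) + lie z (lie x b) + lie x (lie b z))
  + (lie c (lie x y) + lie x (lie y c) + lie y (lie c x))); last first.
  by rewrite Ja Jb Jc !addr0.
by rewrite !addrA [LHS](ACl (1*6*8*4*9*2*7*3*5))%AC.
Qed.

Lemma tderE f t : der f (fl_class t) = tder f t.
Proof. exact/tder_cong/lcong_repr. Qed.

Lemma der_gen f i : der f (gen i) = f i.
Proof. exact: tderE. Qed.

Lemma derD f a b : der f (a + b) = der f a + der f b.
Proof. by rewrite -(fl_reprK a) -(fl_reprK b) -[_ + _ in LHS]fl_addE !tderE. Qed.

Lemma der_lie f a b : der f (lie a b) = lie (der f a) b + lie a (der f b).
Proof. by rewrite -(fl_reprK a) -(fl_reprK b) -fl_lieE !tderE. Qed.

(* [f, g] = g \o f - f \o g, as a homomorphism on H. *)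
Definition der_bracket (f g : homL) : homL :=
  [ffun i => der g (f i) - der f (g i)].

Definition bracket_span (A B : homL -> Prop) : homL -> Prop :=
  zspan (fun h => exists f g, [/\ A f, B g & h = der_bracket f g]).

Definition p_mod (k : nat) : homL -> Prop :=
  zspan (fun f => exists (i : 'I_n) (j : k.-tuple 'I_n),
    f = dual_tensor i (lnorm (rcons (map gen j) (gen i)))).

Definition b_mod (k : nat) (f : homL) : Prop := p_mod k f /\ \sum_i f i = 0.

Definition b_elt (i j l p q r : 'I_n) : homL :=
  let x := gen in
    dual_tensor i (lnorm [:: x r; x q; x p; x l; x j; x i])
  - dual_tensor j (lnorm [:: x r; x q; x p; x l; x i; x j])
  - dual_tensor l (lnorm [:: x r; x q; x p; lie (x j) (x i); x l])
  - dual_tensor p (lnorm [:: x i; x j; x l; lie (x q) (x r); x p])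
  - dual_tensor q (lnorm [:: x i; x j; x l; x p; x r; x q])
  + dual_tensor r (lnorm [:: x i; x j; x l; x p; x q; x r]).

(* With x_1, ..., x_n numbered from 0: n(1, 2, 3) uses the ordinals 0, 1, 2. *)
Definition n_elt (i j l : 'I_n) : homL :=
  b_elt l j i l j i - b_elt l j l i j i.

End FreeLie.

(* Main.v *)
Require Import Defs.
From mathcomp Require Import all_boot all_order all_algebra.
From mathcomp Require Import ring.

Set Implicit Arguments.
Unset Strict Implicit.
Unset Printing Implicit Defensive.

Import GRing.Theory.
Local Open Scope ring_scope.

(** Expand Lie elements in the free associative algebra and look, for a
    derivation h, at the coefficient mod 2 of the word x y x z z y in h(y),
    where x, y, z are the first three generators.  It is additive in h, equals
    1 on n(1, 2, 3) ([coef_n_elt]), and vanishes on every bracket of an element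
    f of b(4) with an element g of b(1) ([coef_bracket_eq0]).

    The vanishing rests on cyclic symmetry.  Write f(x_i) = [u_i, x_i] with u_i
    of weight k.  The coefficient of a w b in the sum of the [u_i, x_i] is that
    of a w in u_b minus that of w b in u_a; so this sum is zero exactly when
    the coefficient of v in u_b depends only on the cyclic word of v b
    ([cyclic_coef]).  Call it c(v b).  For weight 4 the value of c is even on
      - each cyclic word a b b a d, because the coefficient of a b b a in a
        Lie element of weight 4 is zero;
      - the cyclic word x y x z y, which is a rotation of y x y x z, because
        the coefficient of y x y x in a Lie element of weight 4 is even:
        in weight (2, 2) such elements are multiples of
        [x, [y, [x, y]]] = 2 xyxy - 2 yxyx - xxyy + yyxx.
    For weight 1 cyclicity says that g(x_i) is the sum over a of
    s(a, i) [x_a, x_i] with s symmetric.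

    If g(x_i) = [e_i, x_i], then [f, g](x_i) = [v_i, x_i] with
    v_i = g(u_i) - f(e_i) + [u_i, e_i] ([der_bracket_tangential]), and the
    coefficient of x y x z z y in [f, g](y) is that of x y x z z in v_y.
    Applying g to u_i amounts to a sum over pairs of adjacent letters
    ([coef_der]), so this coefficient becomes
      s(x,y) (c(y x z z x) - c(x y z z y))
        + s(x,z) (c(x y z z y) - c(x y x z y))
        + s(y,z) (c(x y x z y) - c(x y x z z)).
    Each cyclic word occurring here is x y x z y or a rotation of some
    a b b a d, so all terms are even.

    Coefficients are taken in any commutative ring as far as possible; the
    parity statements use the field with two elements, which is [bool]. *)

Lemma sum_delta (R : pzRingType) (I : finType) (b : I) (F : I -> R) :
  \sum_i (b == i)%:R * F i = F b.
Proof.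
rewrite (bigD1 b) //= eqxx mul1r big1 ?addr0 // => i.
by rewrite eq_sym => /negPf->; rewrite mul0r.
Qed.

(** * Convolution of functions on words *)

Section WordSeries.
Variables (R : comNzRingType) (A : eqType).
Implicit Types (p q r : seq A -> R) (w : seq A).

(** The product of noncommutative power series.  Recursion on the word, rather
    than a sum over its splittings, makes associativity a plain induction. *)
Fixpoint conv p q w : R :=
  if w is a :: w' then p [::] * q w + conv (fun v => p (a :: v)) q w'
  else p [::] * q [::].

Lemma conv_cons p q a w :
  conv p q (a :: w) = p [::] * q (a :: w) + conv (fun v => p (a :: v)) q w.
Proof. by []. Qed.

Lemma eq_conv p p' q q' w : p =1 p' -> q =1 q' -> conv p q w = conv p' q' w.
Proof.
move=> + Eq; elim: w p p' => [|a w IH] p p' Ep /=; rewrite Ep Eq //.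
by congr (_ + _); apply: IH => v; exact: Ep.
Qed.

Lemma convDl p p' q w :
  conv (fun v => p v + p' v) q w = conv p q w + conv p' q w.
Proof. by elim: w p p' => [|a w IH] p p' /=; rewrite ?IH; ring. Qed.

Lemma convDr p q q' w :
  conv p (fun v => q v + q' v) w = conv p q w + conv p q' w.
Proof. by elim: w p => [|a w IH] p /=; rewrite ?IH; ring. Qed.

Lemma convNl p q w : conv (fun v => - p v) q w = - conv p q w.
Proof. by elim: w p => [|a w IH] p /=; rewrite ?IH; ring. Qed.

Lemma convNr p q w : conv p (fun v => - q v) w = - conv p q w.
Proof. by elim: w p => [|a w IH] p /=; rewrite ?IH; ring. Qed.

Lemma convZl c p q w : conv (fun v => c * p v) q w = c * conv p q w.
Proof. by elim: w p => [|a w IH] p /=; rewrite ?IH; ring. Qed.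

Lemma conv0l p q w : p =1 (fun=> 0) -> conv p q w = 0.
Proof.
by elim: w p => [|a w IH] p p0 /=; rewrite p0 ?IH ?mul0r ?addr0.
Qed.

Lemma convA p q r w : conv p (conv q r) w = conv (conv p q) r w.
Proof.
elim: w p => [|a w IH] p /=; first by ring.
by rewrite IH convDl convZl; ring.
Qed.

(** The action on coefficient functions of the derivation that sends each
    letter b to the sum over a of g a b *: [a, b].  The factor a b of a word
    comes from b with coefficient g a b, and from a with coefficient - g b a;
    hence the two words in which one of the two letters is deleted. *)
Fixpoint adjder (g : A -> A -> R) p w : R :=
  if w is a :: w' then
    if w' is b :: w'' then
      g a b * p w' - g b a * p (a :: w'') + adjder g (fun v => p (a :: v)) w'
    else 0
  else 0.

Lemma adjder_cons2 g p a b w :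
  adjder g p [:: a, b & w] = g a b * p (b :: w) - g b a * p (a :: w)
    + adjder g (fun v => p (a :: v)) (b :: w).
Proof. by []. Qed.

Lemma eq_adjder g p p' w : p =1 p' -> adjder g p w = adjder g p' w.
Proof.
elim: w p p' => [//|a [//|b w] IH] p p' Ep.
by rewrite !adjder_cons2 !Ep; congr (_ + _); apply: IH => v; exact: Ep.
Qed.

Lemma adjderD g p p' w :
  adjder g (fun v => p v + p' v) w = adjder g p w + adjder g p' w.
Proof.
elim: w p p' => [|a [|b w] IH] p p'; rewrite ?adjder_cons2 ?IH /= ?addr0 //.
by ring.
Qed.

Lemma adjderZ g c p w : adjder g (fun v => c * p v) w = c * adjder g p w.
Proof.
elim: w p => [|a [|b w] IH] p; rewrite ?adjder_cons2 ?IH /= ?mulr0 //.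
by ring.
Qed.

Lemma adjderN g p w : adjder g (fun v => - p v) w = - adjder g p w.
Proof.
by rewrite -mulN1r -adjderZ; apply: eq_adjder => v; rewrite mulN1r.
Qed.

(** The splittings of a word with one letter of an adjacent pair deleted
    correspond to the splittings of the whole word that keep the pair
    together. *)
Lemma adjder_conv g p q w :
  adjder g (conv p q) w = conv (adjder g p) q w + conv p (adjder g q) w.
Proof.
elim: w p => [|a [|b w] IH] p; [by rewrite /=; ring | by rewrite /=; ring |].
rewrite adjder_cons2.
rewrite -[X in adjder g X]/(fun v =>
  p [::] * q (a :: v) + conv (fun u => p (a :: u)) q v).
rewrite adjderD (adjderZ _ _ (fun v => q (a :: v))) IH.
rewrite /= !convDl convNl !convZl; ring.
Qed.

End WordSeries.
Arguments adjder : simpl never.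

Lemma adjder_nil_supp (R : comNzRingType) (A : eqType) (g : A -> A -> R)
    (c : R) (w : seq A) :
  adjder g (fun v => (v == [::])%:R * c) w = 0.
Proof.
elim: w c => [//|a [//|b w] IH] c.
rewrite adjder_cons2 /= mulr0n !mul0r !mulr0 subrr add0r.
by rewrite -[RHS](IH 0); apply: eq_adjder => v; rewrite mulr0.
Qed.


(** * Coefficients of Lie elements *)

Section Coefficients.
Variables (n : nat) (R : comNzRingType).
Implicit Types (w : seq 'I_n) (u : freeLie n).

Fixpoint tcoef (t : lterm n) w : R :=
  match t with
  | TGen i => (w == [:: i])%:R
  | TZero => 0
  | TOpp s => - tcoef s w
  | TAdd s u => tcoef s w + tcoef u w
  | TLie s u => conv (tcoef s) (tcoef u) w - conv (tcoef u) (tcoef s) w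
  end.

Lemma tcoef_cong s t : lcong s t -> tcoef s =1 tcoef t.
Proof.
elim=> {s t} /=.
- by [].
- by move=> s t _ E w; rewrite E.
- by move=> s t u _ E _ E' w; rewrite E.
- by move=> s t _ E w; rewrite E.
- by move=> s s' t t' _ E _ E' w; rewrite E E'.
- move=> s s' t t' _ E _ E' w.
  by rewrite (eq_conv _ E E') (eq_conv _ E' E).
- by move=> s t u w; rewrite addrA.
- by move=> s t w; rewrite addrC.
- by move=> t w; rewrite add0r.
- by move=> t w; rewrite addNr.
- by move=> s t u w; rewrite convDl convDr; ring.
- by move=> s t u w; rewrite convDl convDr; ring.
- by move=> t w; rewrite subrr.
- move=> s t u w; rewrite !(convDl, convDr, convNl, convNr) !convA; ring.
Qed.

Definition coef u w : R := tcoef (repr u) w.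

Lemma coef_class t w : coef (fl_class t) w = tcoef t w.
Proof. exact/tcoef_cong/lcong_repr. Qed.

Lemma coef0 w : coef 0 w = 0.
Proof. exact: (coef_class TZero). Qed.

Lemma coef_gen i w : coef (gen i) w = (w == [:: i])%:R.
Proof. exact: (coef_class (TGen i)). Qed.

Lemma coefD u v w : coef (u + v) w = coef u w + coef v w.
Proof.
by rewrite -(fl_reprK u) -(fl_reprK v) -[_ + _ in LHS]fl_addE !coef_class.
Qed.

Lemma coefN u w : coef (- u) w = - coef u w.
Proof. by rewrite -(fl_reprK u) -[- _ in LHS]fl_oppE !coef_class. Qed.

Lemma coefB u v w : coef (u - v) w = coef u w - coef v w.
Proof. by rewrite coefD coefN. Qed.

Lemma coef_sum (I : finType) (F : I -> freeLie n) w :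
  coef (\sum_i F i) w = \sum_i coef (F i) w.
Proof. by elim/big_rec2: _ => [|i x y _ <-]; rewrite ?coef0 ?coefD. Qed.

Lemma coef_lie u v w :
  coef (lie u v) w = conv (coef u) (coef v) w - conv (coef v) (coef u) w.
Proof.
rewrite -{1}(fl_reprK u) -{1}(fl_reprK v) -fl_lieE coef_class /=.
by congr (_ - _); apply: eq_conv.
Qed.

Lemma conv_gen_l i (p : seq 'I_n -> R) w :
  conv (coef (gen i)) p w =
  if w is a :: w' then (a == i)%:R * p w' else 0.
Proof.
case: w => [|a w] /=; rewrite coef_gen mul0r ?add0r //.
case: w => [|b w] /=; rewrite coef_gen eqseq_cons ?andbT //.
by rewrite conv0l ?addr0 // => v; rewrite coef_gen eqseq_cons andbF.
Qed.

Lemma conv_gen_r i (p : seq 'I_n -> R) w :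
  conv p (coef (gen i)) w =
  if w is a :: w' then (last a w' == i)%:R * p (belast a w') else 0.
Proof.
case: w => [|a w]; first by rewrite /= coef_gen mulr0.
rewrite [RHS]/=.
elim: w a p => [|b w IH] a p; rewrite conv_cons coef_gen eqseq_cons.
  by rewrite /= coef_gen mulr0 addr0 andbT mulrC.
by rewrite IH /= andbF mulr0 add0r.
Qed.

Lemma coef_lie_gen u i w :
  coef (lie u (gen i)) w =
  if w is a :: w' then
    (last a w' == i)%:R * coef u (belast a w') - (a == i)%:R * coef u w'
  else 0.
Proof.
by rewrite coef_lie conv_gen_l conv_gen_r; case: w => [|a w]; rewrite ?subrr.
Qed.

Lemma freeLie_ind (P : freeLie n -> Prop) :
  P 0 -> (forall i, P (gen i)) -> (forall u, P u -> P (- u)) ->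
  (forall u v, P u -> P v -> P (u + v)) ->
  (forall u v, P u -> P v -> P (lie u v)) -> forall u, P u.
Proof.
move=> P0 Pg PN PD PL u; rewrite -(fl_reprK u).
elim: (repr u) => [i||s Ps|s Ps t Pt|s Ps t Pt].
- exact: Pg.
- exact: P0.
- by rewrite fl_oppE; exact: PN.
- by rewrite fl_addE; exact: PD.
- by rewrite fl_lieE; exact: PL.
Qed.

Lemma der0 (f : homL n) : der f 0 = 0.
Proof. exact: (tderE f TZero). Qed.

Lemma derN (f : homL n) u : der f (- u) = - der f u.
Proof. by rewrite -(fl_reprK u) -[- _ in LHS]fl_oppE !tderE. Qed.

Lemma derB (f : homL n) u v : der f (u - v) = der f u - der f v.
Proof. by rewrite derD derN. Qed.

(** Being a linear combination of generators, in the form in which it is used: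
    an additive map to R is then known from its values on generators. *)
Definition linear_elt e :=
  forall F : freeLie n -> R, {morph F : u v / u - v} ->
    F e = \sum_a coef e [:: a] * F (gen a).

Lemma coef_linear e w : linear_elt e -> size w != 1 -> coef e w = 0.
Proof.
move=> eL sw; rewrite (eL (coef ^~ w)) => [|u v]; last exact: coefB.
apply: big1 => a _; rewrite coef_gen.
by case: (w =P [:: a]) sw => [->|]; rewrite ?mulr0.
Qed.

(** Both sides are derivations in u, the right-hand one by [adjder_conv], so
    they need only be compared on generators. *)
Lemma coef_der (g e : homL n) :
  (forall i, linear_elt (e i)) -> (forall i, g i = lie (e i) (gen i)) ->
  forall u w, coef (der g u) w =
              adjder (fun a b => coef (e b) [:: a]) (coef u) w.
Proof.
move=> eL ge; elim/freeLie_ind => [w|i w|u Pu w|u v Pu Pv w|u v Pu Pv w].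
- rewrite der0 coef0.
  rewrite -[LHS](adjder_nil_supp (fun a b => coef (e b) [:: a]) 0 w).
  by apply: eq_adjder => v; rewrite coef0 mulr0.
- rewrite der_gen ge coef_lie_gen (eq_adjder _ _ (coef_gen i)).
  case: w => [//|a [|b w]].
    by rewrite /= subrr.
  rewrite adjder_cons2.
  have -> : adjder (fun a b => coef (e b) [:: a])
       (fun v => (a :: v == [:: i])%:R) (b :: w) = 0.
    rewrite -(adjder_nil_supp (fun a b => coef (e b) [:: a]) (a == i)%:R
                              (b :: w)).
    apply: eq_adjder => v; rewrite eqseq_cons.
    by case: eqP; case: eqP; rewrite ?mulr1 ?mulr0.
  rewrite !eqseq_cons addr0; case: w => [|c w].
    rewrite /= !andbT.
    case: (eqVneq a i) => [->|_]; case: (eqVneq b i) => [->|_];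
      by rewrite ?mulr0n !(mul1r, mul0r, mulr1, mulr0).
  by rewrite !(@coef_linear (e i)) ?andbF //=; ring.
- rewrite derN coefN Pu -adjderN; apply: eq_adjder => v; exact/esym/coefN.
- by rewrite derD coefD Pu Pv -adjderD; apply: eq_adjder => z; rewrite coefD.
rewrite der_lie coefD !coef_lie.
rewrite [RHS](eq_adjder _ _ (coef_lie u v)) adjderD adjderN !adjder_conv.
rewrite (eq_conv _ Pu (frefl _)) (eq_conv _ (frefl _) Pu).
rewrite (eq_conv _ Pv (frefl _)) (eq_conv _ (frefl _) Pv); ring.
Qed.

Lemma coef_der_linear (f : homL n) e w : linear_elt e ->
  coef (der f e) w = \sum_a coef e [:: a] * coef (f a) w.
Proof.
move=> eL; rewrite (eL (fun u => coef (der f u) w)) => [|u v].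
  by apply: eq_bigr => a _; rewrite der_gen.
by rewrite derB coefB.
Qed.

(** Only u_a and u_b contribute to the coefficient of a w b in the sum of the
    brackets [u_i, x_i], the latter with a w and the former with w b. *)
Lemma cyclic_coef (f u : homL n) a b w :
  (forall i, f i = lie (u i) (gen i)) -> \sum_i f i = 0 ->
  coef (u b) (a :: w) = coef (u a) (rcons w b).
Proof.
move=> fu f0; apply/eqP; rewrite -subr_eq0; apply/eqP.
rewrite -[RHS](coef0 (a :: rcons w b)) -f0 coef_sum.
under eq_bigr => i _ do rewrite fu coef_lie_gen last_rcons belast_rcons.
by rewrite sumrB !sum_delta.
Qed.

End Coefficients.

(** * Derivations of the form x_i |-> [u_i, x_i] *)

Section Tangential.
Variable n : nat.
Implicit Types (f g u e : homL n).

Lemma lieBl (a b c : freeLie n) : lie (a - b) c = lie a c - lie b c.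
Proof. by apply/eqP; rewrite eq_sym subr_eq -lieDl subrK. Qed.

Lemma lie0l (a : freeLie n) : lie 0 a = 0.
Proof. by rewrite -[X in lie X a](subrr a) lieBl subrr. Qed.

Lemma lieBr (a b c : freeLie n) : lie a (b - c) = lie a b - lie a c.
Proof. by rewrite ![lie a _]lieC lieBl opprB opprK addrC. Qed.

Definition lnorm_span k : freeLie n -> Prop :=
  zspan (fun v => exists j : k.-tuple 'I_n, v = lnorm (map (@gen n) j)).

Lemma p_modP k f : p_mod k.+1 f ->
  exists2 u : homL n, forall i, lnorm_span k.+1 (u i)
                    & forall i, f i = lie (u i) (gen i).
Proof.
elim=> {f} [|f [i [j ->]]|f g _ [u Su fu] _ [v Sv gv]].
- exists [ffun=> 0] => i; rewrite !ffunE; first exact: zspan0.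
  by rewrite lie0l.
- exists (dual_tensor i (lnorm (map (@gen n) j))) => m; rewrite !ffunE.
    by case: eqP => _; [apply: zspan_mem; exists j | exact: zspan0].
  case: eqP => [->|_]; last by rewrite lie0l.
  by case/tupleP: j => a s /=; rewrite foldl_rcons.
exists (u - v) => i; rewrite !ffunE; first exact: zspanB (Su i) (Sv i).
by rewrite fu gv lieBl.
Qed.

Lemma linear_span (R : comNzRingType) (e : freeLie n) :
  lnorm_span 1 e -> linear_elt R e.
Proof.
move=> eS F FB; elim: e / eS => [|_ [j ->]|u v _ Fu _ Fv].
- by rewrite -{1}(subrr 0) FB subrr big1 // => a _; rewrite coef0 mul0r.
- have -> : lnorm (map (@gen n) j) = gen (thead j).
    by case/tupleP: j => a j; rewrite (tuple0 j) theadE.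
  under eq_bigr => a _ do rewrite coef_gen eqseq_cons andbT eq_sym.
  by rewrite sum_delta.
by rewrite FB Fu Fv -sumrB; apply: eq_bigr => a _; rewrite coefB mulrBl.
Qed.

(** The Jacobi identity merges [u_i, [e_i, x_i]] - [e_i, [u_i, x_i]] into
    [[u_i, e_i], x_i]. *)
Lemma der_bracket_tangential f g u e :
  (forall i, f i = lie (u i) (gen i)) -> (forall i, g i = lie (e i) (gen i)) ->
  forall i, der_bracket f g i =
    lie (der g (u i) - der f (e i) + lie (u i) (e i)) (gen i).
Proof.
move=> fu ge i; rewrite ffunE fu ge !der_lie !der_gen fu ge lieDl lieBl.
set x := gen i; have := lie_jacobi (u i) (e i) x.
rewrite (lieC x (u i)) (lieC x (lie _ _)) -(sub0r (lie (u i) x)) lieBr.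
rewrite (lieC _ 0) lie0l oppr0 sub0r => /eqP; rewrite subr_eq0 => /eqP <-.
by rewrite opprD addrACA.
Qed.

End Tangential.

(** * The parity obstruction *)

Section Parity.
Variable n : nat.
Implicit Types (a b x y z : 'I_n).

(** Reversing words multiplies the coefficients of a Lie element of weight 4
    by -1, which kills the palindrome a b b a; in weight (2, 2) the Lie elements
    are the multiples of [a, [b, [a, b]]], whence the parity at a b a b.  On a
    left-normed bracket of generators both are finite Boolean checks. *)
Lemma coef_lnorm4 (u : freeLie n) a b : lnorm_span 4 u ->
  coef bool u [:: a; b; b; a] = 0 /\ coef bool u [:: a; b; a; b] = 0.
Proof.
move=> uS; elim: u / uS => [|_ [j ->]|u v _ [Pu Qu] _ [Pv Qv]].
- by rewrite !coef0.
- case/tupleP: j => j1 j; case/tupleP: j => j2 j; case/tupleP: j => j3 j.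
  case/tupleP: j => j4 j; rewrite (tuple0 j) /=.
  rewrite !coef_lie_gen /= !coef_lie_gen /= !coef_gen !eqseq_cons !andbT.
  by do !case: (_ == _).
by rewrite !coefB Pu Qu Pv Qv.
Qed.

Lemma coef_bracket_eq0 (f g : homL n) x y z : x != y ->
  b_mod 4 f -> b_mod 1 g ->
  coef bool (der_bracket f g y) [:: x; y; x; z; z; y] = 0.
Proof.
move=> xy [/p_modP[u uS fu] f0] [/p_modP[e eS ge] g0].
have eL i : linear_elt bool (e i) by exact: linear_span.
have cyc a b w := cyclic_coef bool a b w fu f0.
have sym a b : coef bool (e b) [:: a] = coef bool (e a) [:: b].
  exact: (cyclic_coef bool a b [::] ge g0).
have pal a b c : coef bool (u c) [:: a; b; b; a] = 0.
  by case: (coef_lnorm4 a b (uS c)).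
rewrite (der_bracket_tangential fu ge) coef_lie_gen /= (negPf xy) eqxx.
rewrite mul0r subr0 mul1r coefD coefB.
have -> : coef bool (lie (u y) (e y)) [:: x; y; x; z; z] =
    coef bool (e y) [:: z] * coef bool (u y) [:: x; y; x; z]
    - coef bool (e y) [:: x] * coef bool (u y) [:: y; x; z; z].
  rewrite (eL y (fun v => coef bool (lie (u y) v) _)) => [|v w]; last first.
    by rewrite lieBr coefB.
  under eq_bigr => a _ do
    rewrite coef_lie_gen /= mulrBr mulrCA [X in _ - X]mulrCA.
  by rewrite sumrB !sum_delta.
have -> : coef bool (der f (e y)) [:: x; y; x; z; z] =
    coef bool (e y) [:: z] * coef bool (u z) [:: x; y; x; z]
    - coef bool (e y) [:: x] * coef bool (u x) [:: y; x; z; z].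
  rewrite coef_der_linear //.
  under eq_bigr => a _ do
    rewrite fu coef_lie_gen /= mulrBr mulrCA [X in _ - X]mulrCA.
  by rewrite sumrB !sum_delta.
rewrite (coef_der eL ge) !adjder_cons2.
(* The values of c on the four cyclic words of the formula, each rotated until
   [coef_lnorm4] applies. *)
have cyxzzx : coef bool (u x) [:: y; x; z; z] = 0 by rewrite cyc; exact: pal.
have cxyzzy : coef bool (u y) [:: x; y; z; z] = 0 by rewrite cyc; exact: pal.
have cxyxzz : coef bool (u z) [:: x; y; x; z] = 0 by rewrite cyc.
have cxyxzy : coef bool (u y) [:: x; y; x; z] = 0.
  by rewrite 4!cyc /=; case: (coef_lnorm4 y x (uS z)).
rewrite cyxzzx cxyzzy cxyxzz cxyxzy (sym y x) /adjder /=.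
ring.
Qed.

Lemma coef_n_elt x y z : x != y -> y != z -> x != z ->
  coef bool (n_elt x y z y) [:: x; y; x; z; z; y] = 1.
Proof.
move=> xy yz xz; rewrite /n_elt /b_elt /dual_tensor !ffunE.
rewrite !eqxx (negPf yz) (eq_sym y x) (negPf xy) /=.
rewrite !(coefB, coefD, coefN, coef0) /=.
have neq := (negPf xy, negPf yz, negPf xz, eq_sym y x, eq_sym z y, eq_sym z x).
do 5!rewrite ?coef_lie_gen ?neq ?eqxx /=.
by rewrite !coef_gen !eqseq_cons !neq ?eqxx.
Qed.

End Parity.

Theorem proposition8p15 (n : nat) (hn : (3 <= n)%N) :
  let i1 := widen_ord hn (@Ordinal 3 0 isT) in
  let i2 := widen_ord hn (@Ordinal 3 1 isT) in
  let i3 := widen_ord hn (@Ordinal 3 2 isT) in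
  ~ bracket_span (@b_mod n 4) (@b_mod n 1) (n_elt i1 i2 i3).
Proof.
move=> i1 i2 i3 nS.
suff: coef bool (n_elt i1 i2 i3 i2) [:: i1; i2; i1; i3; i3; i2] = 0.
  by rewrite coef_n_elt.
elim: (n_elt i1 i2 i3) / nS => [|_ [f [g [fb gb ->]]]|f g _ Ef _ Eg].
- by rewrite ffunE coef0.
- exact: coef_bracket_eq0.
by rewrite !ffunE coefB Ef Eg subrr.
Qed.
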